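(* Finite abelian racks on a set $X$ are in one-to-one correspondence with partitions $X=X_1\sqcup\dotsb\sqcup X_r$ of $X$ together with families of permutations $f_{ij}\in\mathrm{Sym}(X_i)$ for $1\leq i,j\leq r$ such that: (1) $f_{ij}f_{ik}=f_{ik}f_{ij}$ for all $1\leq i,j,k\leq r$; (2) if $\mathcal G_i$ is the subgroup of $\mathrm{Sym}(X_i)$ generated by $\{f_{ij}:1\leq j\leq r\}$, then $\mathcal G_ix_i=X_i$ for each $1\leq i\leq r$ and $x_i\in X_i$ (here $\mathcal G_ix_i$ denotes the orbit of $x_i$ with respect to the action of $\mathcal G_i$ on $X_i$); (3) if $g\in\mathcal G_i$ for some $1\leq i\leq r$ has a fixed point, then $g=\mathrm{id}$. Moreover, the decomposition and permutations above correspond to an abelian quandle provided $f_{ii}=\mathrm{id}$ for each $1\leq i\leq r$.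
   Context: A rack is a set $X$ with a binary operation $\triangleleft$ such that $(x\triangleleft y)\triangleleft z=(x\triangleleft z)\triangleleft(y\triangleleft z)$ for all $x,y,z\in X$, and for each $y\in X$ the map $X\to X$, $x\mapsto x\triangleleft y$, is a bijection. It is a quandle if, furthermore, $x\triangleleft x=x$ for each $x\in X$. A rack (or quandle) is abelian if $(x\triangleleft y)\triangleleft z=(x\triangleleft z)\triangleleft y$ for all $x,y,z\in X$. $\mathrm{Sym}(Y)$ denotes the group of permutations of a set $Y$. *)

(* Defs.v *)
From mathcomp Require Import all_boot all_fingroup.

Set Implicit Arguments.
Unset Strict Implicit.
Unset Printing Implicit Defensive.

Local Open Scope group_scope.

Section Racks.
Variables (X : Type) (op : X -> X -> X).
Local Notation "x ◁ y" := (op x y) (at level 40, left associativity).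

Definition is_rack :=
  (forall x y z, (x ◁ y) ◁ z = (x ◁ z) ◁ (y ◁ z)) /\
  (forall y, bijective (fun x => x ◁ y)).

Definition is_quandle := is_rack /\ (forall x, x ◁ x = x).

Definition is_abelian := forall x y z, (x ◁ y) ◁ z = (x ◁ z) ◁ y.

End Racks.

(* The index set {1, ..., r} is the set of blocks itself: a decomposition into
   nonempty parts is a set partition, considered up to relabelling its parts.
   Without this quotient the correspondence with racks would not be
   one-to-one. *)
Notation block P := {A : {set _} | A \in P}.

Notation elt i := {x | x \in val i}.

Record rack_datum (X : finType) := RackDatum {
  parts : {set {set X}};
  partsP : partition parts [set: X];
  perms : forall i : block parts, block parts -> {perm (elt i)}
}.

Arguments perms {X} _ _ _.

Section RackDatum.
Variables (X : finType) (d : rack_datum X).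

Definition perm_group (i : block (parts d)) : {group {perm (elt i)}} :=
  <<[set perms d i j | j : block (parts d)]>>%G.

Definition admissible :=
  [/\ forall i j k : block (parts d),
        perms d i j * perms d i k = perms d i k * perms d i j,
      forall (i : block (parts d)) (x : elt i),
        orbit 'P (perm_group i) x = [set: elt i]
    & forall (i : block (parts d)) (g : {perm (elt i)}),
        g \in perm_group i -> (exists x, g x = x) -> g = 1].

Lemma mem_cover_parts (x : X) : x \in cover (parts d).
Proof. by rewrite (cover_partition (partsP d)) inE. Qed.

Definition block_of (x : X) : block (parts d) :=
  exist _ (pblock (parts d) x) (pblock_mem (mem_cover_parts x)).

Definition in_block (x : X) : elt (block_of x) :=
  exist _ x (etrans (mem_pblock (parts d) x) (mem_cover_parts x)).

(* For x in X_i and y in X_j this is f_ij (x). *)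
Definition datum_op (x y : X) : X :=
  val (perms d (block_of x) (block_of y) (in_block x)).

End RackDatum.

(* Main.v *)
(** The parts of a datum are the orbits of the group generated by the right
    translations of its operation, and [f_ij] is the translation by any element
    of [X_j], restricted to [X_i]; so the operation determines the datum.
    Conversely, in an abelian rack
    [(x ◁ z) ◁ (y ◁ z) = (x ◁ y) ◁ z = (x ◁ z) ◁ y], and [x ◁ z] is arbitrary,
    so the translation by [y] only depends on the orbit of [y].  Condition (3)
    holds because a transitive abelian permutation group acts freely. *)
Require Import Defs.
From mathcomp Require Import boolp classical_sets functions.
From mathcomp Require Import all_boot all_fingroup.

Set Implicit Arguments.
Unset Strict Implicit.
Unset Printing Implicit Defensive.

Local Open Scope group_scope.

(** In a finite group a generated subgroup consists of products of generators, so no case for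
    inverses is needed. *)
Lemma gen_ind (gT : finGroupType) (A : {set gT}) (P : gT -> Prop) :
    P 1 -> (forall g h, P g -> P h -> P (g * h)) ->
    (forall g, g \in A -> P g) ->
  forall g, g \in <<A>> -> P g.
Proof.
move=> P1 PM PA g /gen_prodgP[n [c cA ->]].
by elim/big_ind: _ => // i _; apply: PA.
Qed.

Lemma part_nonempty (T : finType) (P : {set {set T}}) (D : {set T}) :
  partition P D -> forall i : block P, exists x, x \in val i.
Proof.
case/and3P=> _ _ P0 [A AP]; apply/set0Pn.
by apply: contraNneq P0 => /= <-.
Qed.

(** * Orbits under the right translations *)

Section Translations.
Variables (X : finType) (op : X -> X -> X).

(** Permutations that agree with some translation, so that orbits make sense before the translations
    are known to be bijective. *)
Definition translations : {set {perm X}} :=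
  [set s : {perm X} | [exists y, [forall x, s x == op x y]]].

Definition inner_orbit (x : X) : {set X} := orbit 'P <<translations>> x.

Lemma inner_orbit_partition :
  partition (inner_orbit @: [set: X]) [set: X].
Proof.
by apply: orbit_partition; apply/actsP => g _ x; rewrite !inE.
Qed.

Hypothesis opI : forall y, injective (op^~ y).

Lemma translation_in y : perm (@opI y) \in translations.
Proof. by rewrite inE; apply/existsP; exists y; apply/forallP => x; rewrite permE. Qed.

Lemma op_inner_orbit x y : op x y \in inner_orbit x.
Proof.
apply/orbitP; exists (perm (@opI y)); first by rewrite mem_gen ?translation_in.
by rewrite /= apermE permE.
Qed.

End Translations.

(** * From an abelian rack to a datum *)

Section AbelianRack.
Variables (X : finType) (op : X -> X -> X).
Hypotheses (rack_op : is_rack op) (abelian_op : is_abelian op).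

Lemma rack_op_inj y : injective (op^~ y).
Proof. exact: bij_inj (rack_op.2 y). Qed.

Lemma op_translation x y z : op x (op y z) = op x y.
Proof.
have [w _ wK] := rack_op.2 z.
by rewrite -(wK x) -rack_op.1 abelian_op.
Qed.

Lemma op_orbit x y z : z \in inner_orbit op y -> op x z = op x y.
Proof.
case/orbitP => g gG /= <-; rewrite apermE.
elim/gen_ind: gG y => [y|g1 g2 IH1 IH2 y|s + y]; first by rewrite perm1.
  by rewrite permM IH2.
by rewrite inE => /existsP[t /forallP/(_ y)/eqP->]; rewrite op_translation.
Qed.

Notation parts := (inner_orbit op @: [set: X]).
Let orbitsP := inner_orbit_partition op.

Lemma op_block (i : block parts) x y : x \in val i -> op x y \in val i.
Proof.
case: i => A /= /imsetP[a _ ->] ax.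
by apply: (orbit_trans _ ax); apply: (op_inner_orbit rack_op_inj).
Qed.

(** A point of [j] is chosen to translate by; [op_orbit] makes the choice immaterial. *)
Definition rack_perm_fun (i j : block parts) (x : elt i) : elt i :=
  exist _ (op (val x) (xchoose (part_nonempty orbitsP j))) (op_block _ (valP x)).

Lemma rack_perm_fun_inj i j : injective (@rack_perm_fun i j).
Proof. by move=> x y /(congr1 val) /= /rack_op_inj /val_inj. Qed.

Definition datum_of_rack : rack_datum X :=
  RackDatum (inner_orbit_partition op)
    (fun i j => perm (@rack_perm_fun_inj i j)).

Lemma perms_datum_of_rack (i j : block parts) (x : elt i) y :
  y \in val j -> val (perms datum_of_rack i j x) = op (val x) y.
Proof.
rewrite permE /=; have := xchooseP (part_nonempty orbitsP j).
move: (xchoose _) => z; case: j => A /= /imsetP[a _ ->] za ya.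
by rewrite (op_orbit _ za) (op_orbit _ ya).
Qed.

Lemma datum_of_rackK : datum_op datum_of_rack = op.
Proof.
apply/funext => x; apply/funext => y; rewrite /datum_op.
by rewrite (@perms_datum_of_rack _ _ _ y) //= (valP (in_block datum_of_rack y)).
Qed.

Lemma perms_datum_of_rackC (i j k : block parts) :
  commute (perms datum_of_rack i j) (perms datum_of_rack i k).
Proof.
apply/permP => x; apply: val_inj; rewrite !permM.
have [[y yj] [z zk]] := (part_nonempty orbitsP j, part_nonempty orbitsP k).
by rewrite !(perms_datum_of_rack _ yj, perms_datum_of_rack _ zk) abelian_op.
Qed.

Lemma datum_of_rack_transitive (i : block parts) (x : elt i) :
  orbit 'P (perm_group (d := datum_of_rack) i) x = [set: elt i].
Proof.
apply/setP => z; rewrite inE.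
have: val z \in inner_orbit op (val x).
  case: i x z => A /= AP [x /= xA] [z /= zA]; case/imsetP: AP xA zA => a _ ->.
  by move=> xa za; apply: (orbit_trans za); rewrite orbit_sym.
case/orbitP => g gG /=; rewrite apermE => gxz.
(* [h] need only agree with [g] at the given point, which is generalised in the induction: [h2] is
   chosen at [h1 x]. *)
suff [h hG hx] : exists2 h, h \in perm_group (d := datum_of_rack) i
                          & val (h x) = g (val x).
  by apply/orbitP; exists h => //; apply: val_inj; rewrite /= apermE hx.
elim/gen_ind: gG x {z gxz} => [x|g1 g2 IH1 IH2 x|s + x].
- by exists 1; rewrite ?group1 ?perm1.
- have [h1 h1G h1x] := IH1 x; have [h2 h2G h2x] := IH2 (h1 x).
  by exists (h1 * h2); rewrite ?groupM // !permM h2x h1x.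
rewrite inE => /existsP[t /forallP/(_ (val x))/eqP->].
pose j := block_of datum_of_rack t.
exists (perms datum_of_rack i j); first by apply/mem_gen/imsetP; exists j.
by apply: perms_datum_of_rack; apply: (valP (in_block datum_of_rack t)).
Qed.

End AbelianRack.

(** A permutation that commutes with a group and fixes a point fixes the whole orbit of that point,
    here all of [T]. *)
Lemma abelian_transitive_free (T : finType) (G : {group {perm T}}) g :
    abelian G -> (forall x, orbit 'P G x = [set: T]) ->
  g \in G -> (exists x, g x = x) -> g = 1.
Proof.
move=> cGG trG gG [x gx]; apply/permP => z; rewrite perm1.
have: z \in orbit 'P G x by rewrite trG inE.
case/orbitP => h hG /= <-; rewrite apermE -permM.
by rewrite (centsP cGG _ hG _ gG) permM gx.
Qed.

(** * From a datum to an abelian rack *)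

Section Datum.
Variables (X : finType) (d : rack_datum X).

Lemma block_of_mem (i : block (parts d)) x : x \in val i -> block_of d x = i.
Proof.
by move=> xi; apply: val_inj; apply: def_pblock (partition_trivIset (partsP d)) (valP i) xi.
Qed.

(** Absorbs the transport between [elt i] and [elt (block_of d x)], so that any blocks known to
    contain the arguments can be used. *)
Lemma datum_opE (i j : block (parts d)) (x : elt i) y :
  y \in val j -> datum_op d (val x) y = val (perms d i j x).
Proof.
move/block_of_mem <-; have := block_of_mem (valP x).
case: x => x xi /= xE; case: i / xE xi => xi.
by congr (val (perms d _ _ _)); apply: val_inj.
Qed.

Lemma block_of_datum_op x y : block_of d (datum_op d x y) = block_of d x.
Proof. exact: block_of_mem (valP _). Qed.

Lemma datum_op_block x y z :
  block_of d y = block_of d z -> datum_op d x y = datum_op d x z.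
Proof. by rewrite /datum_op => ->. Qed.

Lemma datum_op_inj y : injective (datum_op d ^~ y).
Proof.
move=> a b eq_ab.
have ab : block_of d a = block_of d b.
  by rewrite -(block_of_datum_op a y) eq_ab block_of_datum_op.
(* [b] is retyped as a point of the block of [a], so that one permutation moves both. *)
have bi : b \in val (block_of d a) by rewrite ab (valP (in_block d b)).
have yj := valP (in_block d y).
move: eq_ab; rewrite (datum_opE (in_block d a) yj).
rewrite (datum_opE (exist _ b bi : elt (block_of d a)) yj).
by move/val_inj/perm_inj/(congr1 val).
Qed.

Hypothesis admd : admissible d.

Lemma datum_op_abelian : is_abelian (datum_op d).
Proof.
case: admd => comm _ _ x y z.
have [yj zk] := (valP (in_block d y), valP (in_block d z)).
rewrite !(datum_opE (in_block d x) yj, datum_opE (in_block d x) zk).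
rewrite (datum_opE _ yj) (datum_opE _ zk).
by rewrite -!permM comm.
Qed.

Lemma datum_op_rack : is_rack (datum_op d).
Proof.
split=> [x y z|y]; last exact: injF_bij (@datum_op_inj y).
(* [y ◁ z] stays in the block of [y], so the two translate alike and self-distributivity reduces to
   commutation. *)
by rewrite datum_op_abelian; apply/esym/datum_op_block/block_of_datum_op.
Qed.

(** Translations preserve blocks, so orbits lie in blocks; conversely, by condition (2), two points
    of a block are joined by a product of the [f_ij], each of which is a translation on that
    block. *)
Lemma pblock_parts x : pblock (parts d) x = inner_orbit (datum_op d) x.
Proof.
case: admd => _ tr _; apply/setP => z; apply/idP/idP; last first.
  case/orbitP => g gG /= <-; rewrite apermE.
  suff /(congr1 val) /= <- : block_of d (g x) = block_of d x.
    exact: valP (in_block d (g x)).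
  elim/gen_ind: gG x => [x|g1 g2 IH1 IH2 x|s + x]; first by rewrite perm1.
    by rewrite permM IH2.
  by rewrite inE => /existsP[t /forallP/(_ x)/eqP->]; rewrite block_of_datum_op.
move=> zx; pose z' : elt (block_of d x) := exist _ z zx.
have: z' \in orbit 'P (perm_group (block_of d x)) (in_block d x).
  by rewrite tr inE.
case/orbitP => k kG /(congr1 val) /= <-; rewrite apermE.
suff: forall u, val (k u) \in inner_orbit (datum_op d) (val u) by apply.
elim/gen_ind: kG => [u|g h IHg IHh u|_ /imsetP[j _ ->] u].
- by rewrite perm1; apply: orbit_refl.
- by rewrite permM; apply: orbit_trans (IHh _) (IHg _).
have [y yj] := part_nonempty (partsP d) j.
rewrite -(datum_opE _ yj); apply: op_inner_orbit.
exact: datum_op_inj.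
Qed.

(** The right-hand side depends on the operation alone, so admissible data with equal operations
    have equal parts. *)
Lemma parts_inner_orbit :
  parts d = inner_orbit (datum_op d) @: [set: X].
Proof.
apply/setP => A; apply/idP/imsetP => [AP|[x _ ->]].
  have [x /= xA] := part_nonempty (partsP d) (exist _ A AP).
  exists x => //; rewrite -pblock_parts.
  by rewrite (def_pblock (partition_trivIset (partsP d)) AP xA).
by rewrite -pblock_parts; apply: valP (block_of d x).
Qed.

End Datum.

Lemma perms_inj (X : finType) (d1 d2 : rack_datum X) :
    parts d1 = parts d2 -> datum_op d1 = datum_op d2 -> d1 = d2.
Proof.
(* The parts are identified first, as the type of [perms] depends on them; the partition proofs are
   then equal by irrelevance. *)
case: d1 d2 => [P hP f1] [P2 hP2 f2] /= eP; case: P2 / eP hP2 f2 => hP2.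
rewrite (eq_irrelevance hP2 hP) => f2 eq_op; congr RackDatum.
apply/functional_extensionality_dep => i; apply/funext => j.
apply/permP => x; apply: val_inj.
(* Translation by a point of [j] recovers [f_ij]. *)
have [y yj] := part_nonempty hP j.
have := congr1 (fun op => op (val x) y) eq_op.
rewrite (datum_opE (d := RackDatum hP f1) x yj).
by rewrite (datum_opE (d := RackDatum hP f2) x yj).
Qed.

Theorem proposition2p12 (X : finType) :
  set_bij [set d : rack_datum X | admissible d]%classic
          [set op : X -> X -> X | is_rack op /\ is_abelian op]%classic
          (@datum_op X)
  /\ (forall d : rack_datum X, admissible d ->
        ((is_quandle (datum_op d) /\ is_abelian (datum_op d)) <->
         (forall i : block (parts d), perms d i i = 1%g))).
Proof.
split; first split.
- by move=> d admd; split; [apply: datum_op_rack | apply: datum_op_abelian].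
- move=> d1 d2 /set_mem adm1 /set_mem adm2 eq_op.
  by apply: perms_inj => //; rewrite !parts_inner_orbit // eq_op.
- move=> op [rack_op abelian_op].
  exists (datum_of_rack rack_op); last exact: datum_of_rackK.
  split.
  + exact: perms_datum_of_rackC.
  + exact: datum_of_rack_transitive.
  move=> i g.
  apply: abelian_transitive_free => [|x]; last exact: datum_of_rack_transitive.
  rewrite abelian_gen; apply/centsP => _ /imsetP[j _ ->] _ /imsetP[k _ ->].
  exact: perms_datum_of_rackC.
move=> d admd; split=> [[[_ idem] _] i | perms1].
  apply/permP => x; apply: val_inj.
  (* Since [x] lies in [X_i], [f_ii x] is [x ◁ x]. *)
  by rewrite -(datum_opE x (valP x)) idem perm1.
split; last exact: datum_op_abelian.
by split=> [|x]; [apply: datum_op_rack | rewrite /datum_op perms1 perm1].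
Qed.
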